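(* Let $L(\mathbf z)$ be the field associated with the space $V=\mathrm{Fun}\,M$, $M=\{(a,b,c)\in\mathbb C^3:c\ne0,\ c\neq ab\}$, with commutation relation $$[L(\mathbf z),L(\mathbf w)]=\partial_3L(\mathbf w)\,\delta_V(\mathbf z-\mathbf w)-\partial_2L(\mathbf w)\,\partial_1^{w}\delta_V(\mathbf z-\mathbf w)+\partial_1L(\mathbf w)\,\partial_2^{w}\delta_V(\mathbf z-\mathbf w)+3\,L(\mathbf w)\,\partial_3^{w}\delta_V(\mathbf z-\mathbf w).$$ Then this commutation relation satisfies the skew-symmetry and Jacobi identity axioms; that is, the bilinear bracket $[L_f,L_g]$ $(f,g\in V)$ determined by it on the space $\{L_f: f\in V\}$ of coefficients of $L(\mathbf z)$ is a Lie bracket.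
   Context: $V=\mathbb C[a,b,c,c^{-1},(c-ab)^{-1}]$, with derivations $\partial_1=\frac{\partial}{\partial a}$, $\partial_2=\frac{\partial}{\partial b}+a\frac{\partial}{\partial c}$, $\partial_3=\frac{\partial}{\partial c}$ (so $[\partial_1,\partial_2]=\partial_3$, and $\partial_3$ is central). The functions $a^nc^m(c-ab)^l$ ($n\ge0$, $m,l\in\mathbb Z$) and $b^nc^m(c-ab)^l$ ($n>0$, $m,l\in\mathbb Z$) form a basis of $V$, and $\mathrm{Res}\,f$ is the coefficient of $\frac1{c(c-ab)}$ in the expansion of $f\in V$ in this basis; one has $\mathrm{Res}(\partial_if)=0$, and the form $\mathrm{Res}(fg)$ is non-degenerate. The generalized delta function $\delta_V(\mathbf z-\mathbf w)$, where $\mathbf z,\mathbf w$ are two copies of the coordinates $(a,b,c)$, is the formal distribution characterized by $\mathrm{Res}_{\mathbf z}\,f(\mathbf z)\,\delta_V(\mathbf z-\mathbf w)=f(\mathbf w)$ for $f\in V$; consequently $\mathrm{Res}_{\mathbf z}\,f(\mathbf z)\,\partial_i^w\delta_V(\mathbf z-\mathbf w)=(\partial_if)(\mathbf w)$. Here $\partial_i^w$ means $\partial_i$ acting in the variables $\mathbf w$. A field $X(\mathbf z)$ on $V$ is a formal distribution determined by its coefficients $X_f=\mathrm{Res}_{\mathbf z}\,f(\mathbf z)X(\mathbf z)$, depending linearly on $f\in V$; its derivative is given by $(\partial_iX)_f=-X_{\partial_if}$. For the field $L$, the coefficient space is the vector space with $f\mapsto L_f$ a linear isomorphism from $V$ onto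 it. A commutation relation for fields is interpreted by multiplying it by $f(\mathbf z)g(\mathbf w)$ and applying $\mathrm{Res}_{\mathbf w}\mathrm{Res}_{\mathbf z}$; thus the relation above means $$[L_f,L_g]=(\partial_3L)_{fg}-(\partial_2L)_{g\,\partial_1f}+(\partial_1L)_{g\,\partial_2f}+3\,L_{g\,\partial_3f},\qquad f,g\in V.$$ *)

(* Defs.v *)
From HB Require Import structures.
From mathcomp Require Import all_boot all_order all_algebra.
From mathcomp Require Import boolp.
From mathcomp Require Import mpoly ring.

Set Implicit Arguments.
Unset Strict Implicit.
Unset Printing Implicit Defensive.

Import GRing.Theory.
Local Open Scope ring_scope.

Notation "x %:F" := (FracField.tofrac x) : ring_scope.

Section FunM.
Variable F : fieldType.

(* F(a, b, c), with (a, b, c) = ('X_0, 'X_1, 'X_2), as an F-algebra. *)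
Definition ratfun : Type := {fraction {mpoly F[3]}}.

HB.instance Definition _ := GRing.Field.on ratfun.

Definition ratfun_scale (k : F) (x : ratfun) : ratfun := (k%:MP)%:F * x.

Fact ratfun_scaleA k l x :
  ratfun_scale k (ratfun_scale l x) = ratfun_scale (k * l) x.
Proof. by rewrite /ratfun_scale mulrA -rmorphM -rmorphM. Qed.

Fact ratfun_scale1 : left_id 1 ratfun_scale.
Proof. by move=> x; rewrite /ratfun_scale !rmorph1 mul1r. Qed.

Fact ratfun_scaleDr : right_distributive ratfun_scale +%R.
Proof. by move=> k x y; rewrite /ratfun_scale mulrDr. Qed.

Fact ratfun_scaleDl x : {morph ratfun_scale^~ x : k l / k + l}.
Proof. by move=> k l; rewrite /ratfun_scale !rmorphD mulrDl. Qed.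

HB.instance Definition _ := GRing.Zmodule_isLmodule.Build F ratfun
  ratfun_scaleA ratfun_scale1 ratfun_scaleDr ratfun_scaleDl.

Fact ratfun_scaleAl k (x y : ratfun) : k *: (x * y) = (k *: x) * y.
Proof. exact: mulrA. Qed.

HB.instance Definition _ :=
  GRing.Lmodule_isLalgebra.Build F ratfun ratfun_scaleAl.
HB.instance Definition _ := GRing.Lalgebra_isComAlgebra.Build F ratfun.

Definition pvarA : {mpoly F[3]} := 'X_(inord 0).
Definition pvarB : {mpoly F[3]} := 'X_(inord 1).
Definition pvarC : {mpoly F[3]} := 'X_(inord 2).

Definition denM (m n : nat) : {mpoly F[3]} :=
  pvarC ^+ m * (pvarC - pvarA * pvarB) ^+ n.

Definition regularM : {pred ratfun} := fun x =>
  `[< exists (p : {mpoly F[3]}) (m n : nat), x = p%:F / (denM m n)%:F >].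

Lemma pvarC_neq0 : pvarC != 0.
Proof.
apply/eqP => /(congr1 (fun p => p@_U_(inord 2))).
by rewrite mcoeff0 mcoeffX eqxx; apply/eqP; rewrite oner_eq0.
Qed.

Lemma pvarCAB_neq0 : pvarC - pvarA * pvarB != 0.
Proof.
apply/eqP => /(congr1 (fun p => p@_U_(inord 2))).
rewrite mcoeff0 mcoeffB -mpolyXD !mcoeffX eqxx.
suff /negPf-> : (U_(inord 0) + U_(inord 1) != U_(inord 2) :> 'X_{1..3})%MM.
  by rewrite subr0; apply/eqP; rewrite oner_eq0.
apply/eqP => /(congr1 (fun m : 'X_{1..3} => m (inord 0))).
by rewrite mnmDE !mnm1E eqxx -!val_eqE /= !inordK.
Qed.

Lemma denM_neq0 m n : denM m n != 0.
Proof. by rewrite mulf_neq0 // expf_neq0 ?pvarC_neq0 ?pvarCAB_neq0. Qed.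

Lemma denMM m n m' n' : denM m n * denM m' n' = denM (m + m') (n + n').
Proof. by rewrite /denM mulrACA -!exprD. Qed.

Lemma regularMP x :
  reflect (exists (p : {mpoly F[3]}) (m n : nat), x = p%:F / (denM m n)%:F)
          (x \in regularM).
Proof. exact: asboolP. Qed.

Lemma regularM_poly p : (p%:F : ratfun) \in regularM.
Proof.
by apply/regularMP; exists p, 0, 0; rewrite /denM !expr0 mulr1 rmorph1 divr1.
Qed.

Fact regularM_subalg : GRing.subalg_closed regularM.
Proof.
split=> [|k|].
- by rewrite -[1]tofrac1 regularM_poly.
- move=> x y /regularMP[p [m [n ->]]] /regularMP[q [m' [n' ->]]].
  apply/regularMP.
  exists (k%:MP * p * denM m' n' + q * denM m n), (m + m')%N, (n + n')%N.
  rewrite -denMM [k *: _]mulrA -tofracM addf_div ?tofrac_eq0 ?denM_neq0 //.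
  by rewrite -!tofracM -tofracD.
- move=> x y /regularMP[p [m [n ->]]] /regularMP[q [m' [n' ->]]].
  apply/regularMP; exists (p * q), (m + m')%N, (n + n')%N.
  by rewrite -denMM !tofracM mulf_div.
Qed.

HB.instance Definition _ :=
  GRing.isSubalgClosed.Build F ratfun regularM regularM_subalg.

(* The coordinate ring F[a, b, c, c^-1, (c - ab)^-1]. *)
Record funM : Type := FunM {
  funM_val : ratfun;
  funM_valP : funM_val \in regularM
}.

HB.instance Definition _ := [isSub for funM_val].
HB.instance Definition _ := [Choice of funM by <:].
HB.instance Definition _ := [SubChoice_isSubAlgebra of funM by <:].
HB.instance Definition _ := [SubNzRing_isSubComNzRing of funM by <:].

(* The partial derivatives on F(a, b, c), by the quotient rule; the value does
   not depend on the representative of the fraction, see ratfun_pderivE. *)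
Definition ratfun_pderiv (i : 'I_3) (x : ratfun) : ratfun :=
  let n := \n_(repr x) in let d := \d_(repr x) in
  (mderiv i n * d - n * mderiv i d)%:F / (d ^+ 2)%:F.


Lemma ratfun_numden (x : ratfun) :
  x = (\n_(repr x))%:F / (\d_(repr x))%:F.
Proof.
set r := repr x; have r0 : \d_r != 0 := denom_ratioP r.
rewrite -[LHS]reprK -/r -[r in LHS]FracField.Ratio_numden.
unlock FracField.tofrac.
rewrite -[X in _ = _ * X]FracField.pi_inv -[RHS]FracField.pi_mul.
rewrite /FracField.mulf /FracField.invf.
by rewrite !(numden_Ratio, oner_eq0, mulr1, mul1r).
Qed.

Lemma ratfun_pderivE i (x : ratfun) (n d : {mpoly F[3]}) :
  d != 0 -> x = n%:F / d%:F ->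
  ratfun_pderiv i x = (mderiv i n * d - n * mderiv i d)%:F / (d ^+ 2)%:F.
Proof.
move=> d0 xE; rewrite /ratfun_pderiv; have := ratfun_numden x.
have := denom_ratioP (repr x); move: (\n_(repr x)) (\d_(repr x)) => n1 d1 d10.
rewrite xE => /eqP; rewrite eqr_div ?tofrac_eq0 // -!tofracM tofrac_eq.
move=> /eqP nd; have D := congr1 (mderiv i) nd.
rewrite !mderivM in D.
apply/eqP; rewrite eqr_div ?tofrac_eq0 ?expf_neq0 // -!tofracM tofrac_eq.
apply/eqP; apply/subr0_eq.
transitivity ((n * d1 - n1 * d) * (mderiv i d1 * d + mderiv i d * d1)
  - (mderiv i n * d1 + n * mderiv i d1 - (mderiv i n1 * d + n1 * mderiv i d))
    * (d * d1)); first by ring.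
by rewrite nd D !subrr !mul0r subr0.
Qed.

Fact ratfun_pderiv_linear i : linear (ratfun_pderiv i).
Proof.
move=> k x y; have d0 := denom_ratioP (repr x); have e0 := denom_ratioP (repr y).
have := ratfun_numden x; have := ratfun_numden y.
move: d0 e0 (\n_(repr x)) (\n_(repr y)).
move: (\d_(repr x)) (\d_(repr y)) => d e d0 e0 n m yE xE.
rewrite (ratfun_pderivE i d0 xE) (ratfun_pderivE i e0 yE).
have zE : k *: x + y = (k%:MP * n * e + m * d)%:F / (d * e)%:F.
  rewrite xE yE [k *: _]mulrA -tofracM addf_div ?tofrac_eq0 //.
  by rewrite -!tofracM -tofracD.
rewrite (ratfun_pderivE i _ zE) ?mulf_neq0 // [k *: _]mulrA -tofracM.
rewrite addf_div ?tofrac_eq0 ?expf_neq0 // -!tofracM -tofracD.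
congr (_%:F / _%:F); last by ring.
by rewrite mderivD !mderivM mderivC; ring.
Qed.

HB.instance Definition _ i := GRing.isLinear.Build F ratfun ratfun _
  (ratfun_pderiv i) (ratfun_pderiv_linear i).

Lemma denM_pderiv i m n : exists q,
  mderiv i (denM m n) * denM 1 1 = q * denM m n.
Proof.
have key (t : {mpoly F[3]}) k : mderiv i (t ^+ k) * t = mderiv i t *+ k * t ^+ k.
  elim: k => [|k IH]; first by rewrite expr0 mderivC !mul0r.
  by rewrite exprS mderivM mulrDl -mulrA -[t * _ * t]mulrA IH mulrS; ring.
have /= K1 := key pvarC m; have /= K2 := key (pvarC - pvarA * pvarB) n.
rewrite /denM !expr1 mderivM.
set c := pvarC in K1 K2 *; set e := (c - _) in K2 *.
exists (mderiv i c *+ m * e + mderiv i e *+ n * c).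
transitivity (mderiv i (c ^+ m) * c * e ^+ n * e
  + mderiv i (e ^+ n) * e * c ^+ m * c); first by ring.
by rewrite K1 K2; ring.
Qed.

Lemma ratfun_pderiv_regular i x :
  x \in regularM -> ratfun_pderiv i x \in regularM.
Proof.
move=> /regularMP[p [m [n xE]]].
rewrite (ratfun_pderivE i (denM_neq0 m n) xE).
have [q qE] := denM_pderiv i m n.
apply/regularMP; exists (mderiv i p * denM 1 1 - p * q), (1 + m)%N, (1 + n)%N.
rewrite -denMM; apply/eqP.
rewrite eqr_div ?tofrac_eq0 ?expf_neq0 ?(mulf_neq0 (denM_neq0 _ _)) //
        ?denM_neq0 //.
rewrite -!tofracM tofrac_eq; apply/eqP.
transitivity (mderiv i p * denM 1 1 * denM m n ^+ 2
   - p * (mderiv i (denM m n) * denM 1 1) * denM m n); first by ring.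
by rewrite qE; ring.
Qed.

(* d/da, d/db + a d/dc and d/dc *)
Definition ratfun_d1 : ratfun -> ratfun := ratfun_pderiv (inord 0).
Definition ratfun_d2 (x : ratfun) : ratfun :=
  ratfun_pderiv (inord 1) x + (pvarA%:F : ratfun) * ratfun_pderiv (inord 2) x.
Definition ratfun_d3 : ratfun -> ratfun := ratfun_pderiv (inord 2).

Fact funM_d1_subproof (f : funM) : ratfun_d1 (funM_val f) \in regularM.
Proof. exact/ratfun_pderiv_regular/funM_valP. Qed.

Fact funM_d2_subproof (f : funM) : ratfun_d2 (funM_val f) \in regularM.
Proof.
have fV := funM_valP f.
apply: rpredD; last apply: rpredM;
  by rewrite ?regularM_poly ?ratfun_pderiv_regular.
Qed.

Fact funM_d3_subproof (f : funM) : ratfun_d3 (funM_val f) \in regularM.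
Proof. exact/ratfun_pderiv_regular/funM_valP. Qed.

Definition funM_d1 (f : funM) : funM := FunM (funM_d1_subproof f).
Definition funM_d2 (f : funM) : funM := FunM (funM_d2_subproof f).
Definition funM_d3 (f : funM) : funM := FunM (funM_d3_subproof f).

Fact funM_d1_linear : linear funM_d1.
Proof. by move=> k f g; apply/val_inj; rewrite /= /ratfun_d1 linearP. Qed.

Fact funM_d2_linear : linear funM_d2.
Proof.
move=> k f g; apply/val_inj; rewrite /= /ratfun_d2 !linearP /=.
by rewrite mulrDr scalerDr -scalerAr addrACA.
Qed.

Fact funM_d3_linear : linear funM_d3.
Proof. by move=> k f g; apply/val_inj; rewrite /= /ratfun_d3 linearP. Qed.

HB.instance Definition _ := GRing.isLinear.Build F funM funM _
  funM_d1 funM_d1_linear.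
HB.instance Definition _ := GRing.isLinear.Build F funM funM _
  funM_d2 funM_d2_linear.
HB.instance Definition _ := GRing.isLinear.Build F funM funM _
  funM_d3 funM_d3_linear.

End FunM.

Section Fields.
Variables (F : fieldType) (U : lmodType F).
Local Notation V := (funM F).

(* A formal distribution X(z) with coefficients in U is identified with the
   functional f |-> X_f = Res_z f(z) X(z); likewise a formal distribution in
   z and w with (f, g) |-> Res_w Res_z f(z) g(w) X(z, w). *)
Definition dfield : Type := {linear V -> U}.
Definition dfield2 : Type := V -> V -> U.

Definition dfield_deriv (d : {linear V -> V}) (X : dfield) : dfield :=
  \- (X \o d).

(* A distribution K(z, w) whose partial residues Res_z f(z) K(z, w) lie in V,
   as functions of w, is identified with f |-> Res_z f(z) K(z, w). *)
Definition dkernel : Type := {linear V -> V}.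

(* Res_z f(z) delta(z - w) = f(w) *)
Definition delta : dkernel := idfun.

(* The derivation d acting in the variables w. *)
Definition dkernel_deriv (d : {linear V -> V}) (K : dkernel) : dkernel :=
  d \o K.

(* X(w) K(z, w): Res_w g(w) X(w) (Res_z f(z) K(z, w)) = X_(g * K f) *)
Definition dfield_mul (X : dfield) (K : dkernel) : dfield2 :=
  fun f g => X (g * K f).

(* The right-hand side of the commutation relation
   [L(z), L(w)] = d3 L(w) delta(z - w) - d2 L(w) d1^w delta(z - w)
                  + d1 L(w) d2^w delta(z - w) + 3 L(w) d3^w delta(z - w). *)
Definition commutator_dist (L : dfield) : dfield2 := fun f g =>
  dfield_mul (dfield_deriv (@funM_d3 F) L) delta f g
  - dfield_mul (dfield_deriv (@funM_d2 F) L)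
      (dkernel_deriv (@funM_d1 F) delta) f g
  + dfield_mul (dfield_deriv (@funM_d1 F) L)
      (dkernel_deriv (@funM_d2 F) delta) f g
  + 3 *: dfield_mul L (dkernel_deriv (@funM_d3 F) delta) f g.

Definition commutation_relation (L : dfield) (br : U -> U -> U) : Prop :=
  forall f g : V, br (L f) (L g) = commutator_dist L f g.

Definition skew_symmetric (br : U -> U -> U) : Prop :=
  forall x y, br x y = - br y x.

Definition jacobi_identity (br : U -> U -> U) : Prop :=
  forall x y z, br x (br y z) + br y (br z x) + br z (br x y) = 0.

End Fields.

(* Main.v *)
Require Import Defs.
From HB Require Import structures.
From mathcomp Require Import all_boot all_order all_algebra.
From mathcomp Require Import boolp reals.
From mathcomp Require Import complex mpoly.
From mathcomp Require Import ring.

Import GRing.Theory.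
Local Open Scope ring_scope.

(** The relation says that [L_f, L_g] = L_{f, g}, where, after the derivatives
    of L are moved onto the test functions,
      {f, g} = - d3 (g f) + d2 (g d1 f) - d1 (g d2 f) + 3 g d3 f.
    The terms where d1 d2 and d2 d1 hit f combine to - g [d1, d2] f = - g d3 f,
    and what is left is the Lagrange (contact) bracket
      {f, g} = d1 f d2 g - d2 f d1 g + g d3 f - f d3 g
    of the Heisenberg frame (d1, d2, d3): compare contact_bracketE. It is
    visibly alternating. Its Jacobi identity uses only that d1, d2, d3 are
    derivations of a commutative ring with [d1, d2] = d3 and d3 central; this is
    contact_bracket_jacobi. Geometrically, f is the Hamiltonian of the contact
    vector field X_f = d1 f d2 - d2 f d1 - f d3, and [X_f, X_g] = X_{f, g}.

    There remains to see that d1, d2, d3 are such derivations on Fun M. Partial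
    derivatives of rational functions satisfy the Leibniz rule; they commute
    because their commutator is a derivation that vanishes on polynomials, and
    such a derivation vanishes on all fractions (derivation_eq0). *)

(** * The contact bracket of a Heisenberg triple of derivations *)

Section ContactBracket.
Variables (A : comNzRingType) (d1 d2 d3 : {additive A -> A}).

Definition leibniz {T : pzRingType} (d : T -> T) : Prop :=
  forall f g, d (f * g) = d f * g + f * d g.

Definition contact_bracket (f g : A) : A :=
  d1 f * d2 g - d2 f * d1 g + g * d3 f - f * d3 g.

Lemma contact_bracketC f g : contact_bracket f g = - contact_bracket g f.
Proof. by rewrite /contact_bracket; ring. Qed.

Hypotheses (d1M : leibniz d1) (d2M : leibniz d2) (d3M : leibniz d3).
Hypothesis d12 : forall f, d1 (d2 f) = d2 (d1 f) + d3 f.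
Hypothesis d13 : forall f, d1 (d3 f) = d3 (d1 f).
Hypothesis d23 : forall f, d2 (d3 f) = d3 (d2 f).

(** The coefficient 3 is one for each derivative of f along d3: one cancels
    against d3 (g f), one against the commutator, and one survives as the term
    that makes the bracket alternating. *)
Lemma contact_bracketE f g :
  contact_bracket f g
  = - d3 (g * f) + d2 (g * d1 f) - d1 (g * d2 f) + (g * d3 f) *+ 3.
Proof. by rewrite /contact_bracket d1M d2M d3M d12; ring. Qed.

(** Once every second derivative is written in the order d3, d2, d1, the cyclic
    sum cancels as a polynomial in f, g, h and their derivatives. As for a
    Poisson bracket, the terms with a second derivative cancel; [d1, d2] leaves
    products of three first derivatives such as d2 f d1 g d3 h, which cancel
    those coming from the part g d3 f - f d3 g. *)
Lemma contact_bracket_jacobi f g h :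
  contact_bracket f (contact_bracket g h)
  + contact_bracket g (contact_bracket h f)
  + contact_bracket h (contact_bracket f g) = 0.
Proof.
rewrite /contact_bracket !(raddfB, raddfD) !(d1M, d2M, d3M) !(d12, d13, d23).
ring.
Qed.

End ContactBracket.

(** By contact_bracketC, linearity in one argument is linearity in both. *)
Lemma contact_bracket_linear (F : comNzRingType) (A : comAlgType F)
    (d1 d2 d3 : {linear A -> A}) (f : A) :
  linear (contact_bracket A d1 d2 d3 f).
Proof.
move=> k g h; rewrite /contact_bracket /= !linearP /=.
(* The scalar k becomes a ring element, so that the goal is a ring identity. *)
have [a aE] : exists a : A, forall x, k *: x = a * x.
  by exists k%:A => x; rewrite mulr_algl.
by rewrite !aE; ring.
Qed.

(** * Partial derivatives of rational functions *)

Section RationalFunctions.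
Variable F : fieldType.
Local Notation K := (ratfun F).

Lemma ratfun_pderivM i : leibniz (@ratfun_pderiv F i).
Proof.
move=> x y; have d0 := denom_ratioP (repr x); have e0 := denom_ratioP (repr y).
have := ratfun_numden x; have := ratfun_numden y.
move: d0 e0 (\n_(repr x)) (\n_(repr y)).
move: (\d_(repr x)) (\d_(repr y)) => d e d0 e0 n m yE xE.
rewrite (ratfun_pderivE i d0 xE) (ratfun_pderivE i e0 yE).
have zE : x * y = (n * m)%:F / (d * e)%:F.
  by rewrite xE yE mulf_div -!tofracM.
rewrite (ratfun_pderivE i _ zE) ?mulf_neq0 // xE yE !mulf_div -!tofracM.
rewrite addf_div ?tofrac_eq0 ?mulf_neq0 ?expf_neq0 // -!tofracM -tofracD.
apply/eqP; rewrite eqr_div ?tofrac_eq0 ?mulf_neq0 ?expf_neq0 ?mulf_neq0 //.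
by rewrite -!tofracM tofrac_eq !mderivM; apply/eqP; ring.
Qed.

Lemma ratfun_pderiv_poly i (p : {mpoly F[3]}) :
  ratfun_pderiv i (p%:F : K) = (mderiv i p)%:F.
Proof.
rewrite (ratfun_pderivE (n := p) (d := 1) i) ?oner_eq0 //.
  by rewrite expr1n tofrac1 divr1 mderivC mulr1 mulr0 subr0.
by rewrite tofrac1 divr1.
Qed.

Lemma ratfun_pderivD i : {morph @ratfun_pderiv F i : x y / x + y}.
Proof. exact: raddfD. Qed.

(** If x = n / d then 0 = D n = D (x d) = D x d. *)
Lemma derivation_eq0 (D : K -> K) :
  leibniz D -> (forall p : {mpoly F[3]}, D p%:F = 0) -> forall x, D x = 0.
Proof.
move=> DM D0 x; have d0 := denom_ratioP (repr x).
have d0F : (\d_(repr x))%:F != 0 :> K by rewrite tofrac_eq0.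
have := DM x (\d_(repr x))%:F.
rewrite {1}(ratfun_numden x) divfK // !D0 mulr0 addr0 => /esym/eqP.
by rewrite mulf_eq0 (negPf d0F) orbF => /eqP.
Qed.

Lemma ratfun_pderivC i j (x : K) :
  ratfun_pderiv i (ratfun_pderiv j x) = ratfun_pderiv j (ratfun_pderiv i x).
Proof.
apply/subr0_eq; move: x; apply: derivation_eq0 => [x y|p].
  by rewrite !ratfun_pderivM !ratfun_pderivD !ratfun_pderivM; ring.
by rewrite !ratfun_pderiv_poly [X in X%:F - _]mderiv_comm subrr.
Qed.

End RationalFunctions.

(** * The Heisenberg triple on Fun M *)

Section HeisenbergTriple.
Variable F : fieldType.
Local Notation V := (funM F).

Lemma funM_d1M : leibniz (@funM_d1 F).
Proof. by move=> f g; apply/val_inj; rewrite /= /ratfun_d1 ratfun_pderivM. Qed.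

Lemma funM_d2M : leibniz (@funM_d2 F).
Proof.
move=> f g; apply/val_inj; rewrite /= /ratfun_d2 !ratfun_pderivM.
by rewrite 2!mulrDr mulrDl addrACA mulrA [X in _ + (_ + X)]mulrCA.
Qed.

Lemma funM_d3M : leibniz (@funM_d3 F).
Proof. by move=> f g; apply/val_inj; rewrite /= /ratfun_d3 ratfun_pderivM. Qed.

(** The coefficient a of d2 depends on a alone: this is why [d1, d2] = d3 and
    why d3 commutes with d2. *)
Lemma pderiv_pvarA (i : nat) : (i < 3)%N ->
  ratfun_pderiv (inord i) ((pvarA F)%:F : ratfun F) = (i == 0)%:R.
Proof.
move=> i3; rewrite ratfun_pderiv_poly mderivX mnm1E -val_eqE /= !inordK //.
case: (ltngtP i 0%N) => // [_|->]; first by rewrite scale0r tofrac0.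
by rewrite scale1r -{1}[U_(_)%MM]add0m addmK mpolyX0 tofrac1.
Qed.

Lemma funM_d12 (f : V) : funM_d1 (funM_d2 f) = funM_d2 (funM_d1 f) + funM_d3 f.
Proof.
apply/val_inj; rewrite /= /ratfun_d1 /ratfun_d2 /ratfun_d3 ratfun_pderivD.
rewrite (ratfun_pderivM _ _ (pvarA F)%:F) pderiv_pvarA //= mul1r.
by rewrite 2!(ratfun_pderivC _ (inord 0)) addrCA addrC.
Qed.

Lemma funM_d13 (f : V) : funM_d1 (funM_d3 f) = funM_d3 (funM_d1 f).
Proof. by apply/val_inj; rewrite /= /ratfun_d1 /ratfun_d3 ratfun_pderivC. Qed.

Lemma funM_d23 (f : V) : funM_d2 (funM_d3 f) = funM_d3 (funM_d2 f).
Proof.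
apply/val_inj; rewrite /= /ratfun_d2 /ratfun_d3 ratfun_pderivD.
rewrite (ratfun_pderivM _ _ (pvarA F)%:F) pderiv_pvarA //= mul0r add0r.
by rewrite (ratfun_pderivC _ (inord 1)).
Qed.

Definition funM_bracket : V -> V -> V :=
  contact_bracket V (@funM_d1 F) (@funM_d2 F) (@funM_d3 F).

Lemma funM_bracket_linear f : linear (funM_bracket f).
Proof.
exact: (contact_bracket_linear F V (@funM_d1 F) (@funM_d2 F) (@funM_d3 F)).
Qed.

(** By definition (d L)_f = - L_{d f}, and multiplication by d^w delta replaces
    f by d f; so the right-hand side is L at the sum in contact_bracketE. *)
Lemma commutator_distE (U : lmodType F) (L : dfield U) (f g : V) :
  commutator_dist L f g = L (funM_bracket f g).
Proof.
rewrite /funM_bracket contact_bracketE;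
  [|exact: funM_d1M|exact: funM_d2M|exact: funM_d3M|exact: funM_d12].
rewrite /commutator_dist /dfield_mul /dfield_deriv /dkernel_deriv /delta /=.
rewrite [RHS]raddfD raddfB raddfD [in RHS]raddfN raddfMn /= opprK.
by rewrite -scaler_nat.
Qed.

End HeisenbergTriple.

Theorem theorem7p1 (R : realType) (U : lmodType R[i]) (L : dfield U)
    (L_bij : bijective L) :
  exists br : {bilinear U -> U -> U},
    [/\ commutation_relation L br,
        forall br' : U -> U -> U, commutation_relation L br' -> br' =2 br,
        skew_symmetric br &
        jacobi_identity br].
Proof.
have [M LK MK] := L_bij.
(* The bracket is transported from Fun M along f |-> L_f. *)
have M_lin : linear M.
  by move=> k u v; apply: (can_inj LK); rewrite linearP !MK.
pose br u v := L (funM_bracket _ (M u) (M v)).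
have brC : skew_symmetric br.
  by move=> u v; rewrite /br /funM_bracket contact_bracketC raddfN.
have brr u : linear (br u).
  by move=> k v w; rewrite /br M_lin funM_bracket_linear linearP.
have br_bilin : bilinear_for *:%R *:%R br.
  split=> // v k u w.
  by rewrite brC brr opprD -scalerN -!brC.
pose BR := HB.pack_for {bilinear U -> U -> U} br
  (bilinear_isBilinear.Build _ _ _ _ _ _ br br_bilin).
exists BR; split=> // [f g|br' br'E u v|u v w].
- by rewrite commutator_distE /= /br !LK.
- by rewrite -[u in LHS]MK -[v in LHS]MK br'E commutator_distE.
rewrite /= /br !LK -!raddfD /= contact_bracket_jacobi ?raddf0 //.
- exact: funM_d1M.
- exact: funM_d2M.
- exact: funM_d3M.
- exact: funM_d12.
- exact: funM_d13.
- exact: funM_d23.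
Qed.
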